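(* Every quiver in the class $\mathcal{B}$ of Banff quivers is mutation-equivalent to a quiver in the class $\mathcal{B}'$ of Banff prime quivers; i.e., $\mathcal{B}=\mathcal{B}'$.
   Context: A quiver $Q=(Q_0,Q_1)$ is a finite multidigraph (multiple arrows allowed) without loops and directed 2-cycles, with vertex set $Q_0$ and arrow set $Q_1$. It is acyclic if it contains no directed cycles. A vertex $i$ is a source (respectively sink) if no arrow ends (respectively begins) at $i$. For $S\subseteq Q_0$, $Q\setminus S$ denotes the full subquiver induced by the vertices $Q_0\setminus S$, i.e. all arrows of $Q$ that start and end in $Q_0\setminus S$. Mutation of $Q$ at a vertex $i$: $\mu_i(Q)$ is obtained from $Q$ by (1) for each path $j\to i\to k$ of length 2 through $i$ (counted with multiplicity) adding an arrow $j\to k$; (2) reversing all arrows that begin or end at $i$; (3) deleting (cancelling, pair by pair) the 2-cycles that have appeared as a result of step (1). All vertices are mutable. Two quivers are mutation-equivalent if one is obtained from the other by a finite sequence of mutations. A bi-infinite path in $Q$ is a sequence $(i_a)_{a\in\mathbb{Z}}$ of vertices such that $i_a\to i_{a+1}$ is an arrow of $Q$ for every $a\in\mathbb{Z}$ (vertices may repeat). A pair of vertices $(i,j)$ is a covering pair if $i\to j$ is an arrow in $Q$ which is not part of any bi-infinite path. The class $\mathcal{B}$ of Banff quivers is the smallest class of quivers such that: any acyclic quiver is in $\mathcal{B}$; any quiver mutation-equivalent to a quiver in $\mathcal{B}$ is in $\mathcal{B}$; and any quiver $Q$ with a covering pair $(i,j)$ such that both $Q\setminus\{i\}$ and $Q\setminus\{j\}$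 are in $\mathcal{B}$ is in $\mathcal{B}$. The class $\mathcal{B}'$ of Banff prime quivers is the smallest class of quivers such that: any quiver without arrows is in $\mathcal{B}'$; any quiver mutation-equivalent to a quiver in $\mathcal{B}'$ is in $\mathcal{B}'$; and any quiver $Q$ with an arrow $i\to j$ where $i$ is a source or $j$ is a sink, and such that both $Q\setminus\{i\}$ and $Q\setminus\{j\}$ are in $\mathcal{B}'$, is in $\mathcal{B}'$. *)

(* Defs.v *)
From HB Require Import structures.
From mathcomp Require Import all_boot all_order all_algebra.
Set Implicit Arguments.
Unset Strict Implicit.
Unset Printing Implicit Defensive.

(* [m (i, j)] is the number of arrows from [i] to [j]: no loops and no directed
   2-cycles. *)
Definition is_quiver (V : finType) (m : {ffun V * V -> nat}) : bool :=
  [forall i, m (i, i) == 0] &&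
  [forall i, forall j, (m (i, j) == 0) || (m (j, i) == 0)].

(* The condition is a boolean, so two quivers on [V] are (Leibniz) equal as soon
   as they have the same number of arrows between any two vertices. *)
Record quiver (V : finType) : Type := Quiver {
  mult : {ffun V * V -> nat};
  quiverP : is_quiver mult
}.

HB.instance Definition _ (V : finType) := [isSub for @mult V].

Section Quivers.

Variable V : finType.
Implicit Types (Q : quiver V) (i j k : V).

Definition arrow Q : rel V := fun i j => 0 < mult Q (i, j).

Definition is_source Q i : bool := [forall j, ~~ arrow Q j i].
Definition is_sink Q i : bool := [forall j, ~~ arrow Q i j].

Definition arrowless Q : Prop := forall i j, ~~ arrow Q i j.

Definition acyclic Q : Prop :=
  forall c : seq V, c != [::] -> ~~ cycle (arrow Q) c.

(* The three steps of mutation, on arrow multiplicities.  Truncated subtraction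
   in the last one cancels the 2-cycles pair by pair. *)
Definition add_paths i (m : {ffun V * V -> nat}) : {ffun V * V -> nat} :=
  [ffun p => m p + m (p.1, i) * m (i, p.2)].
Definition reverse_at i (m : {ffun V * V -> nat}) : {ffun V * V -> nat} :=
  [ffun p => if (p.1 == i) || (p.2 == i) then m (p.2, p.1) else m p].
Definition cancel_2cycles (m : {ffun V * V -> nat}) : {ffun V * V -> nat} :=
  [ffun p => m p - m (p.2, p.1)].

Lemma cancel_2cycles_quiver m : is_quiver (cancel_2cycles m).
Proof.
apply/andP; split; apply/forallP=> i; first by rewrite ffunE subnn.
by apply/forallP=> j; rewrite !ffunE !subn_eq0 leq_total.
Qed.

Definition mutate i Q : quiver V :=
  Quiver (cancel_2cycles_quiver (reverse_at i (add_paths i (mult Q)))).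

Definition mutation_equiv Q Q' : Prop :=
  exists s : seq V, foldl (fun R i => mutate i R) Q s = Q'.

Definition biinfinite_path Q (p : int -> V) : Prop :=
  forall a : int, arrow Q (p a) (p (a + 1)%R).

Definition covering_pair Q i j : Prop :=
  arrow Q i j /\
  ~ exists p : int -> V, biinfinite_path Q p /\
      exists a : int, p a = i /\ p (a + 1)%R = j.

Definition sub_mult Q (S : {set V}) :
    {ffun {x : V | x \notin S} * {x : V | x \notin S} -> nat} :=
  [ffun p => mult Q (val p.1, val p.2)].

Lemma sub_mult_quiver Q (S : {set V}) : is_quiver (sub_mult Q S).
Proof.
case/andP: (quiverP Q) => /forallP Q0 /forallP Q2.
apply/andP; split; apply/forallP=> i; first by rewrite ffunE.
by apply/forallP=> j; rewrite !ffunE; apply: (forallP (Q2 _)).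
Qed.

(* Q \ S *)
Definition delete Q (S : {set V}) : quiver {x : V | x \notin S} :=
  Quiver (sub_mult_quiver Q S).

End Quivers.

Inductive banff : forall V : finType, quiver V -> Prop :=
| banff_acyclic (V : finType) (Q : quiver V) :
    acyclic Q -> banff Q
| banff_mutation (V : finType) (Q Q' : quiver V) :
    mutation_equiv Q Q' -> banff Q -> banff Q'
| banff_covering (V : finType) (Q : quiver V) (i j : V) :
    covering_pair Q i j ->
    banff (delete Q [set i]) -> banff (delete Q [set j]) -> banff Q.

Inductive banff_prime : forall V : finType, quiver V -> Prop :=
| banff_prime_arrowless (V : finType) (Q : quiver V) :
    arrowless Q -> banff_prime Q
| banff_prime_mutation (V : finType) (Q Q' : quiver V) :
    mutation_equiv Q Q' -> banff_prime Q -> banff_prime Q'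
| banff_prime_source_sink (V : finType) (Q : quiver V) (i j : V) :
    arrow Q i j -> is_source Q i \/ is_sink Q j ->
    banff_prime (delete Q [set i]) -> banff_prime (delete Q [set j]) ->
    banff_prime Q.

(* Main.v *)
(** A covering pair [(i, j)] cannot have both an infinite path out of [j] and
    an infinite path into [i].  If no infinite path leaves [j], the vertices
    reachable from [j] can be turned into sources one after the other by
    mutations at sinks, which creates no new arrow and eventually makes [j]
    itself a sink.  Neither [i] nor [j] is mutated, so these mutations commute
    with the deletion of [i] and of [j]: the covering rule of the class B
    reduces to the source/sink rule of B' up to mutation.  The other case
    follows by reversing all arrows.  Acyclic quivers are handled in the same
    way, since each of their arrows is a covering pair. *)
Require Import Defs.
From mathcomp Require Import all_boot all_order all_algebra.
From mathcomp Require Import zify.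

Set Implicit Arguments.
Unset Strict Implicit.
Unset Printing Implicit Defensive.

(** * Vertices of a finite digraph from which no infinite path starts *)

Section Terminating.

Variables (T : finType) (e : rel T).

(* Equivalently, there is no infinite [e]-path starting at [x]. *)
Definition terminating x : bool :=
  [forall y, forall z, connect e x y ==> e y z ==> ~~ connect e z y].

Lemma terminatingP x :
  reflect (forall y z, connect e x y -> e y z -> ~~ connect e z y)
          (terminating x).
Proof.
apply: (iffP forallP) => [H y z xy yz | H y].
  by have /forallP/(_ z) := H y; rewrite xy yz.
by apply/forallP=> z; apply/implyP=> xy; apply/implyP=> yz; apply: H yz.
Qed.

Lemma terminating_connect x y :
  connect e x y -> terminating x -> terminating y.
Proof.
move=> xy /terminatingP tx; apply/terminatingP => u v yu.
exact/tx/(connect_trans xy yu).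
Qed.

(** Walking forward must stop: along a step [e x z] the set of reachable vertices shrinks strictly,
    because [x] is not reachable from [z]. *)
Lemma terminating_connect_sink x :
  terminating x -> exists2 y, connect e x y & forall z, ~~ e y z.
Proof.
have [n] := ubnP #|connect e x|; elim: n x => // n IH x /ltnSE-le_n tx.
have [/existsP[z xz] | nx] := boolP [exists z, e x z]; last first.
  by exists x => // z; apply: contra nx => xz; apply/existsP; exists z.
have czx := terminatingP _ tx x z (connect0 _ _) xz.
have [||y zy sink_y] := IH z.
- apply: leq_trans le_n; apply/proper_card/properP; split.
    by apply/subsetP=> u; apply/connect_trans/connect1.
  by exists x; [exact: connect0 | exact: czx].
- exact: terminating_connect (connect1 xz) tx.
by exists y => //; apply: connect_trans (connect1 xz) zy.
Qed.

Lemma non_terminating_step x :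
  ~~ terminating x -> exists2 w, e x w & ~~ terminating w.
Proof.
case/forallPn=> y /forallPn[z]; rewrite 2!negb_imply negbK.
case/and3P=> /connectP[p]; case: p => [_ -> xz zx | w p /=].
  (* Here [x] itself lies on the cycle, and its successor [z] on that cycle does not terminate
     either. *)
  exists z => //; apply/forallPn; exists x; apply/forallPn; exists z.
  by rewrite zx xz.
case/andP=> xw wp y_def yz zy; exists w => //.
apply/forallPn; exists y; apply/forallPn; exists z; rewrite yz zy.
by rewrite (_ : connect e w y) //; apply/connectP; exists p.
Qed.

Lemma infinite_path x :
  ~~ terminating x -> {f : nat -> T | f 0 = x & forall n, e (f n) (f n.+1)}.
Proof.
(* The default [u] is never returned along the iteration, since every vertex met there is
   non-terminating. *)
move=> ntx; pose next u := odflt u [pick w | e u w && ~~ terminating w].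
have nextP u : ~~ terminating u -> e u (next u) && ~~ terminating (next u).
  case/non_terminating_step=> w uw ntw; rewrite /next.
  by case: pickP => //= /(_ w); rewrite uw ntw.
exists (fun n => iter n next x) => // n.
have /nextP/andP[//] : ~~ terminating (iter n next x).
by elim: n => // n /nextP/andP[].
Qed.

End Terminating.

(** * Mutation in closed form, and mutation equivalence *)

Section Mutation.

Variable V : finType.
Implicit Types (Q : quiver V) (i j k : V).

Lemma quiver_ext Q Q' :
  (forall x y, mult Q (x, y) = mult Q' (x, y)) -> Q = Q'.
Proof. by move=> H; apply/val_inj/ffunP => -[x y]; apply: H. Qed.

Lemma mult_loop Q i : mult Q (i, i) = 0.
Proof. by case/andP: (quiverP Q) => /forallP/(_ i)/eqP. Qed.

Lemma mult_2cycle Q i j : mult Q (i, j) = 0 \/ mult Q (j, i) = 0.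
Proof.
case/andP: (quiverP Q) => _ /forallP/(_ i)/forallP/(_ j).
by case/orP=> /eqP; [left | right].
Qed.

(** Without loops, step (1) adds no arrow at [k]; without 2-cycles, step (3) cancels none there. *)
Lemma mult_mutate k Q x y :
  mult (mutate k Q) (x, y) =
    if (x == k) || (y == k) then mult Q (y, x)
    else mult Q (x, y) + mult Q (x, k) * mult Q (k, y)
         - (mult Q (y, x) + mult Q (y, k) * mult Q (k, x)).
Proof.
rewrite /= !ffunE /= [(y == k) || _]orbC.
case: ifP => // /orP[/eqP-> | /eqP->]; rewrite mult_loop ?muln0 ?mul0n !addn0.
- by case: (mult_2cycle Q k y) => ->; rewrite ?subn0 ?sub0n.
- by case: (mult_2cycle Q x k) => ->; rewrite ?subn0 ?sub0n.
Qed.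

Lemma mutateK k Q : mutate k (mutate k Q) = Q.
Proof.
apply: quiver_ext => x y; rewrite !mult_mutate eqxx !orbT /=.
rewrite [(y == k) || _]orbC.
case: ((x == k) || (y == k)) => //.
(* One direction vanishes in each pair of opposite multiplicities, so the truncated subtractions can
   be resolved case by case. *)
by case: (mult_2cycle Q x y) => ->; case: (mult_2cycle Q x k) => ->;
  case: (mult_2cycle Q y k) => ->; rewrite ?mul0n ?muln0; lia.
Qed.

Lemma mutation_equiv_trans Q Q' Q'' :
  mutation_equiv Q Q' -> mutation_equiv Q' Q'' -> mutation_equiv Q Q''.
Proof. by move=> [s <-] [t <-]; exists (s ++ t); rewrite foldl_cat. Qed.

Lemma mutation_equiv_sym Q Q' : mutation_equiv Q Q' -> mutation_equiv Q' Q.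
Proof.
move=> [s <-]; elim: s Q => [|k s IH] Q /=; first by exists [::].
by apply: mutation_equiv_trans (IH _) _; exists [:: k]; rewrite /= mutateK.
Qed.

End Mutation.

(** * Mutations at sinks, and their compatibility with deletion *)

Section SinkMutation.

Variable V : finType.
Implicit Types (Q : quiver V) (i j k : V).

Lemma delete_mutate k Q (S : {set V}) (kS : k \notin S) :
  delete (mutate k Q) S = mutate (exist _ k kS) (delete Q S).
Proof.
by apply: quiver_ext => x y; rewrite ffunE !mult_mutate !ffunE.
Qed.

Lemma mutation_equiv_delete Q (S : {set V}) (s : seq V) :
  {in s, forall k, k \notin S} ->
  mutation_equiv (delete Q S) (delete (foldl (fun R k => mutate k R) Q s) S).
Proof.
elim: s Q => [|k s IH] Q sS /=; first by exists [::].
have kS : k \notin S by apply: sS; rewrite mem_head.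
apply: (mutation_equiv_trans _ (IH (mutate k Q) _)) => [|l sl].
  by exists [:: exist _ k kS]; rewrite /= delete_mutate.
by apply: sS; rewrite inE sl orbT.
Qed.

Lemma arrow_mutate_sink k Q x y : is_sink Q k ->
  arrow (mutate k Q) x y =
    if (x == k) || (y == k) then arrow Q y x else arrow Q x y.
Proof.
move=> /forallP sink_k; rewrite /arrow mult_mutate.
have m0 z : mult Q (k, z) = 0.
  by apply/eqP; have := sink_k z; rewrite -leqNgt leqn0.
case: ifP => // _; rewrite !m0 !muln0 !addn0.
by case: (mult_2cycle Q x y) => ->; rewrite ?subn0 ?sub0n.
Qed.

(** The mutation turns [k] into a source, so a path starting elsewhere never enters [k] and uses
    only old arrows. *)
Lemma connect_mutate_sink k Q x y : is_sink Q k -> x != k ->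
  connect (arrow (mutate k Q)) x y -> y != k /\ connect (arrow Q) x y.
Proof.
move=> sink_k xk /connectP[p]; elim: p x xk => [x xk _ -> // | w p IH x xk /=].
rewrite arrow_mutate_sink // (negPf xk) /= => /andP[].
case: ifP => [/eqP-> xw | /negbT wk xw wp y_def].
  by rewrite (negPf (forallP sink_k x)) in xw.
have [yk wy] := IH w wk wp y_def.
by split; last exact: connect_trans (connect1 xw) wy.
Qed.

(** Induction on the number of vertices reachable from [j]: mutating at a reachable sink [k] removes
    [k] from this set and adds nothing to it. *)
Lemma terminating_mutate_to_sink Q i j :
  arrow Q i j -> terminating (arrow Q) j ->
  exists2 s : seq V, {in s, forall k, k != i /\ k != j} &
    let Q' := foldl (fun R k => mutate k R) Q s in
    arrow Q' i j /\ is_sink Q' j.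
Proof.
have [n] := ubnP #|connect (arrow Q) j|; elim: n Q => // n IH Q /ltnSE-le_n ij tj.
have [sink_j | nsink_j] := boolP (is_sink Q j); first by exists [::].
have [k jk /forallP sink_k] := terminating_connect_sink tj.
have kj : j != k by apply: contraNneq nsink_j => ->.
have ki : i != k.
  by apply: contraTneq ij => ->; apply: (forallP sink_k).
have conn x y := @connect_mutate_sink k Q x y sink_k.
have [|||s s_ij Hs] := IH (mutate k Q).
- apply: leq_trans le_n; apply/proper_card/properP; split.
    by apply/subsetP=> u /(conn _ _ kj)[].
  by exists k => //; apply/negP=> /(conn _ _ kj)[]; rewrite eqxx.
- by rewrite arrow_mutate_sink // (negPf kj) (negPf ki).
(* A cycle reachable from [j] after the mutation avoids [k], hence was already present before. *)
- apply/terminatingP=> y z jy yz; apply/negP=> zy.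
  have [yk jy'] := conn _ _ kj jy.
  have [zk _] := conn _ _ kj (connect_trans jy (connect1 yz)).
  have [_ zy'] := conn _ _ zk zy.
  rewrite arrow_mutate_sink // (negPf yk) (negPf zk) /= in yz.
  by have /negP := terminatingP _ _ tj _ _ jy' yz.
exists (k :: s) => // l; rewrite inE => /predU1P[-> | /s_ij //].
by rewrite eq_sym ki eq_sym kj.
Qed.

End SinkMutation.

(** * Reversal of all arrows, and covering pairs *)

Section Opposite.

Variable V : finType.
Implicit Types (Q : quiver V) (i j k : V).

Lemma opposite_subproof Q :
  is_quiver [ffun p : V * V => mult Q (p.2, p.1)].
Proof.
apply/andP; split; apply/forallP=> x; first by rewrite ffunE mult_loop.
apply/forallP=> y; rewrite !ffunE /=.
by case: (mult_2cycle Q x y) => ->; rewrite eqxx ?orbT.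
Qed.

Definition opposite Q : quiver V := Quiver (opposite_subproof Q).

Lemma arrow_opposite Q i j : arrow (opposite Q) i j = arrow Q j i.
Proof. by rewrite /arrow ffunE. Qed.

Lemma mutate_opposite k Q : mutate k (opposite Q) = opposite (mutate k Q).
Proof.
apply: quiver_ext => x y; rewrite [RHS]ffunE !mult_mutate !ffunE /=.
rewrite [(y == k) || _]orbC; case: ifP => // _.
by rewrite mulnC [X in _ - (_ + X)]mulnC.
Qed.

Lemma foldl_mutate_opposite Q (s : seq V) :
  foldl (fun R k => mutate k R) (opposite Q) s =
  opposite (foldl (fun R k => mutate k R) Q s).
Proof. by elim: s Q => //= k s IH Q; rewrite mutate_opposite IH. Qed.

Lemma covering_pair_terminating Q i j : covering_pair Q i j ->
  terminating (arrow Q) j || terminating (arrow (opposite Q)) i.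
Proof.
case=> ij no_path; apply: contra_notT no_path => /norP[ntj nti].
have [f f0 fS] := infinite_path ntj.
have [g g0 gS] := infinite_path nti.
(* Since [Negz n] is -(n+1), the path [g] is run backwards and reaches [i] at -1, while [f] leaves
   [j] at 0. *)
exists (fun a : int => match a with Posz n => f n | Negz n => g n end).
split; last by exists (Negz 0).
case=> [n | [|n]].
- by rewrite (_ : (Posz n + 1)%R = Posz n.+1) ?fS //; lia.
- by rewrite (_ : (Negz 0 + 1)%R = Posz 0) // g0 f0.
- rewrite (_ : (Negz n.+1 + 1)%R = Negz n); last by lia.
  by rewrite -arrow_opposite gS.
Qed.

End Opposite.

(** * Comparison of the two classes *)

Lemma banff_prime_covering (V : finType) (Q : quiver V) (i j : V) :
  arrow Q i j ->
  terminating (arrow Q) j || terminating (arrow (opposite Q)) i ->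
  banff_prime (delete Q [set i]) -> banff_prime (delete Q [set j]) ->
  banff_prime Q.
Proof.
move=> ij term Qi Qj.
have [s s_ij [ij' ss]] : exists2 s : seq V,
    {in s, forall k, k != i /\ k != j} &
    let Q' := foldl (fun R k => mutate k R) Q s in
    arrow Q' i j /\ (is_source Q' i \/ is_sink Q' j).
  case/orP: term => [tj | ti].
    have [s s_ij [ij' sink_j]] := terminating_mutate_to_sink ij tj.
    by exists s => //; split; last right.
  have ji : arrow (opposite Q) j i by rewrite arrow_opposite.
  (* A sink of the opposite quiver is a source of the original one, and the same sequence [s] serves
     both. *)
  have [s s_ji] := terminating_mutate_to_sink ji ti.
  rewrite foldl_mutate_opposite /= arrow_opposite => -[ij' sink_i].
  exists s => [k /s_ji[] // | /=]; split=> //; left.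
  apply/forallP=> k; rewrite -arrow_opposite; exact: (forallP sink_i).
apply: (@banff_prime_mutation _ (foldl (fun R k => mutate k R) Q s)).
  by apply: mutation_equiv_sym; exists s.
apply: (banff_prime_source_sink ij' ss).
- apply: banff_prime_mutation Qi; apply: mutation_equiv_delete => k /s_ij[ki _].
  by rewrite inE.
- apply: banff_prime_mutation Qj; apply: mutation_equiv_delete => k /s_ij[_ kj].
  by rewrite inE.
Qed.

Lemma acyclic_delete (V : finType) (Q : quiver V) (S : {set V}) :
  acyclic Q -> acyclic (delete Q S).
Proof.
move=> acQ [//|x p] _; apply: contra (acQ (val x :: map val p) isT).
rewrite /= -map_rcons path_map; apply: sub_path => u v.
by rewrite /= /arrow ffunE.
Qed.

Lemma acyclic_terminating (V : finType) (Q : quiver V) (x : V) :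
  acyclic Q -> terminating (arrow Q) x.
Proof.
move=> acQ; apply/terminatingP=> y z _ yz; apply/negP=> /connectP[p zp y_def].
by have /negP[] := acQ (z :: p) isT; rewrite /= rcons_path zp -y_def.
Qed.

(** Induction on the number of vertices: every vertex terminates, so any arrow can be used, and both
    deletions stay acyclic. *)
Lemma acyclic_banff_prime (V : finType) (Q : quiver V) :
  acyclic Q -> banff_prime Q.
Proof.
have [n] := ubnP #|V|; elim: n V Q => // n IH V Q /ltnSE-le_n acQ.
have [/existsP[i /existsP[j ij]] | no_arrow] :=
  boolP [exists i, exists j, arrow Q i j]; last first.
  apply: banff_prime_arrowless => i j; apply: contra no_arrow => ij.
  by apply/existsP; exists i; apply/existsP; exists j.
have prime_delete k : banff_prime (delete Q [set k]).
  apply: IH (acyclic_delete acQ); apply: leq_trans le_n.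
  rewrite card_sig; apply/proper_card/properP; split; first exact/subsetP.
  by exists k => //; rewrite !inE eqxx.
by apply: banff_prime_covering ij _ _ _; rewrite // acyclic_terminating.
Qed.

(** A bi-infinite path through the arrow would also have an arrow into [i] and one out of [j]. *)
Lemma source_sink_covering_pair (V : finType) (Q : quiver V) (i j : V) :
  arrow Q i j -> is_source Q i \/ is_sink Q j -> covering_pair Q i j.
Proof.
move=> ij ss; split=> // -[p [path_p [a [pi pj]]]].
case: ss => /forallP => [/(_ (p (a - 1)%R)) | /(_ (p (a + 1 + 1)%R))].
- by have := path_p (a - 1)%R; rewrite GRing.subrK pi => ->.
- by have := path_p (a + 1)%R; rewrite pj => ->.
Qed.

Theorem theorem3p3 :
  (forall (V : finType) (Q : quiver V), banff Q ->
     exists Q' : quiver V, mutation_equiv Q Q' /\ banff_prime Q') /\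
  (forall (V : finType) (Q : quiver V), banff Q <-> banff_prime Q).
Proof.
have BB' (V : finType) (Q : quiver V) : banff Q -> banff_prime Q.
  elim=> {V Q} [V Q | V Q Q' QQ' _ | V Q i j ij _ Qi _ Qj].
  - exact: acyclic_banff_prime.
  - exact: banff_prime_mutation.
  - exact: banff_prime_covering ij.1 (covering_pair_terminating ij) Qi Qj.
split=> V Q; first by move=> /BB' Q'; exists Q; split=> //; exists [::].
split; first exact: BB'.
elim=> {V Q} [V Q noQ | V Q Q' QQ' _ | V Q i j ij ss _ Qi _ Qj].
- apply: banff_acyclic => -[//|x [|y p]] _ /=.
    by rewrite (negPf (noQ _ _)).
  by rewrite (negPf (noQ _ _)).
- exact: banff_mutation.
- exact: banff_covering (source_sink_covering_pair ij ss) Qi Qj.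
Qed.
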